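(* If $G$ is a graph, then the following are equivalent: (a) $\Omega(G)$ is $\sigma$-compact. (b) $\Omega(G)$ is Menger. (c) $\Omega(G)$ is Lindelöf and does not contain a closed topological copy of the Baire space $\omega^\omega$.
   Context: A graph is a pair $G=(V(G),E(G))$ with $V(G)$ an arbitrary set and $E(G)\subseteq [V(G)]^2$ (two-element subsets). A ray in $G$ is an injective sequence of vertices $(v_0,v_1,\dots)$ with $\{v_i,v_{i+1}\}\in E(G)$ for all $i$; a tail of it is $(v_n,v_{n+1},\dots)$ for some $n$. For finite $F\subseteq V(G)$, $G\setminus F$ is the subgraph induced on $V(G)\setminus F$; a connected component is a maximal connected subgraph. Two rays of $G$ are equivalent if for every finite $F\subseteq V(G)$ they have tails lying in the same connected component of $G\setminus F$. An end is an equivalence class of rays, and $\Omega(G)$ is the set of ends. For an end $\epsilon$ and finite $F\subseteq V(G)$, $G(\epsilon,F)$ is the unique connected component of $G\setminus F$ containing a tail of every ray of $\epsilon$, and $\Omega(\epsilon,F)$ is the set of all ends having a ray contained in $G(\epsilon,F)$. A set $U\subseteq\Omega(G)$ is open if for every $\epsilon\in U$ there is a finite $F\subseteq V(G)$ with $\Omega(\epsilon,F)\subseteq U$; this topologizes $\Omega(G)$, the end space of $G$. A space $X$ is Menger if for every sequence $(\mathcal U_n:n\in\omega)$ of open covers of $X$ there are finite $\mathcal F_n\subseteq\mathcal U_n$ with $X=\bigcup_{n\in\omega}\bigcup\mathcal F_n$. $X$ is Lindelöf if every open cover has a countable subcover, and $\sigma$-compact if it is a countable union of compact subspaces. A closed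 topological copy of $\omega^\omega$ (product topology of discrete $\omega$) is a closed subspace homeomorphic to it. *)

(* Defs.v *)
From HB Require Import structures.
From Stdlib Require Import Relations.
From mathcomp Require Import all_boot all_classical topology.

Set Implicit Arguments.
Unset Strict Implicit.
Unset Printing Implicit Defensive.

Local Open Scope classical_set_scope.

(* A set of two-element subsets of V(G) is the same thing as a symmetric and
   irreflexive relation on V(G). *)
Record graph := Graph {
  vertex :> Type;
  adj : vertex -> vertex -> Prop;
  adj_sym : forall x y, adj x y -> adj y x;
  adj_irr : forall x, ~ adj x x }.
Arguments adj {g} _ _.

Record ray (G : graph) := Ray {
  ray_fun :> nat -> G;
  ray_inj : injective ray_fun;
  ray_adj : forall i, adj (ray_fun i) (ray_fun i.+1) }.

Section EndSpace.
Variable G : graph.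
Implicit Types (F A B C D : set G) (r s t : ray G).

(* The subgraph induced on A is nonempty and connected: any two vertices of A
   are joined by a walk inside A. *)
Definition gconnected A : Prop :=
  A !=set0 /\ forall x y, A x -> A y ->
    clos_refl_trans G (fun u v => [/\ A u, A v & adj u v]) x y.

(* C is the vertex set of a connected component of G \ F.  A maximal connected
   subgraph of G \ F is induced, so it is determined by its vertex set. *)
Definition component F C : Prop :=
  [/\ C `<=` ~` F, gconnected C &
      forall D, D `<=` ~` F -> gconnected D -> C `<=` D -> D `<=` C].

Definition has_tail_in r C : Prop := exists n, forall i, n <= i -> C (r i).

Definition ray_equiv r s : Prop :=
  forall F, finite_set F ->
    exists C, [/\ component F C, has_tail_in r C & has_tail_in s C].

Record graph_end := GraphEnd {
  end_rays : set (ray G);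
  end_rays_class : exists r, end_rays = ray_equiv r }.

HB.instance Definition _ := gen_eqMixin graph_end.
HB.instance Definition _ := gen_choiceMixin graph_end.

Implicit Types (e : graph_end).

(* G(e, F), by definite description; [end_component_spec] and
   [end_component_unique] below justify it for finite F. *)
Definition end_component e F : set G :=
  xget set0 [set C | component F C /\ forall r, end_rays e r -> has_tail_in r C].

(* Omega(e, F) *)
Definition end_basic e F : set graph_end :=
  [set e' | exists2 r, end_rays e' r & forall i, end_component e F (r i)].

Definition end_open (U : set graph_end) : Prop :=
  forall e, U e -> exists2 F, finite_set F & end_basic e F `<=` U.

Lemma gconnectedU A B : gconnected A -> gconnected B -> A `&` B !=set0 ->
  gconnected (A `|` B).
Proof.
move=> [A0 cA] [B0 cB] [z [Az Bz]].
have wk (D D' : set G) x y : D `<=` D' ->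
    clos_refl_trans G (fun u v => [/\ D u, D v & adj u v]) x y ->
    clos_refl_trans G (fun u v => [/\ D' u, D' v & adj u v]) x y.
  move=> DD'; elim=> [u v [Du Dv uv]|u|u v w _ IH1 _ IH2].
  - by apply: rt_step; split=> //; exact: DD'.
  - exact: rt_refl.
  - exact: rt_trans IH1 IH2.
split; first by exists z; left.
have sA : A `<=` A `|` B by move=> u; left.
have sB : B `<=` A `|` B by move=> u; right.
have toz x : (A `|` B) x ->
    clos_refl_trans G
      (fun u v => [/\ (A `|` B) u, (A `|` B) v & adj u v]) x z.
  case=> [Ax|Bx]; first exact: wk sA (cA _ _ Ax Az).
  exact: wk sB (cB _ _ Bx Bz).
have fromz x : (A `|` B) x ->
    clos_refl_trans G
      (fun u v => [/\ (A `|` B) u, (A `|` B) v & adj u v]) z x.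
  case=> [Ax|Bx]; first exact: wk sA (cA _ _ Az Ax).
  exact: wk sB (cB _ _ Bz Bx).
by move=> x y /toz xz /fromz zy; apply: rt_trans xz zy.
Qed.

Lemma component_absorb F C D : component F C -> D `<=` ~` F ->
  gconnected D -> C `&` D !=set0 -> D `<=` C.
Proof.
move=> [CF cC maxC] DF cD CD0 x Dx.
apply: (maxC (C `|` D)); [|exact: gconnectedU|by move=> u; left|by right].
by move=> u [/CF|/DF].
Qed.

Lemma component_eq F C D : component F C -> component F D ->
  C `&` D !=set0 -> C = D.
Proof.
move=> hC hD CD0; have [CF cC _] := hC; have [DF cD _] := hD.
apply/seteqP; split; last exact: component_absorb hC DF cD CD0.
by apply: component_absorb hD CF cC _; rewrite setIC.
Qed.

Lemma component_exists F x : ~ F x -> exists2 C, component F C & C x.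
Proof.
move=> nFx.
pose C := \bigcup_(D in [set D | [/\ D `<=` ~` F, gconnected D & D x]]) D.
have c1 : gconnected [set x].
  by split; [exists x|move=> u v -> ->; exact: rt_refl].
have Cx : C x by exists [set x] => //; split=> // u ->.
exists C => //; split; first by move=> u [D [DF _ _] Du]; exact: DF.
- split; first by exists x.
  move=> u v [D [DF cD Dx] Du] [D' [D'F cD' D'x] D'v].
  have cDD' : gconnected (D `|` D') by apply: gconnectedU => //; exists x.
  have sDD' : D `|` D' `<=` C.
    by move=> w Dw; exists (D `|` D') => //; split=> //;
      [move=> a [/DF|/D'F]|left].
  elim: (cDD'.2 u v (or_introl Du) (or_intror D'v)).
  + by move=> a b [/sDD' Ca /sDD' Cb ab]; apply: rt_step.
  + by move=> a; exact: rt_refl.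
  + by move=> a b c _ + _; exact: rt_trans.
- by move=> D DF cD CD u Du; exists D => //; split=> //; exact: CD.
Qed.

Lemma ray_avoids r F : finite_set F -> exists n, forall i, n <= i -> ~ F (r i).
Proof.
move=> finF; have : finite_set (r @^-1` F).
  by apply: finite_preimage => // i j _ _; exact: ray_inj.
case/finite_fsetP => X XE; exists (\max_(i <- finmap.enum_fset X) i).+1.
move=> i ltXi Fri; have iX : i \in finmap.enum_fset X.
  by have : (r @^-1` F) i by []; rewrite XE.
by move: ltXi; rewrite ltnNge (@leq_bigmax_seq _ _ predT (fun j : nat => j)).
Qed.

Lemma ray_component r F : finite_set F ->
  exists2 C, component F C & has_tail_in r C.
Proof.
move=> /(ray_avoids r) [n nF]; have [C hC Cn] := component_exists (nF n (leqnn n)).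
exists C => //; exists n => i ni; have [CF cC maxC] := hC.
rewrite -(subnKC ni); elim: (i - n) => [|k IH]; first by rewrite addn0.
rewrite addnS; set m := n + k in IH *.
pose D := [set u | u = r m \/ u = r m.+1].
have adjD := ray_adj r m.
apply: (component_absorb (D := D) hC); last by right.
- by move=> u [->|->]; apply: nF; rewrite /m -?addnS leq_addr.
- split; first by exists (r m); left.
  move=> u v [->|->] [->|->]; try exact: rt_refl.
  + by apply: rt_step; split=> //; [left|right].
  + by apply: rt_step; split=> //; [right|left|exact: adj_sym].
- by exists (r m); split=> //; left.
Qed.

Lemma has_tail_in_meet r C D : has_tail_in r C -> has_tail_in r D ->
  C `&` D !=set0.
Proof.
move=> [n nC] [m mD]; exists (r (maxn n m)).
by split; [apply: nC; exact: leq_maxl|apply: mD; exact: leq_maxr].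
Qed.

Lemma ray_equiv_refl r : ray_equiv r r.
Proof. by move=> F /(ray_component r)[C ? ?]; exists C. Qed.

Lemma ray_equiv_sym r s : ray_equiv r s -> ray_equiv s r.
Proof. by move=> rs F /rs[C [? ? ?]]; exists C. Qed.

Lemma ray_equiv_trans r s t : ray_equiv r s -> ray_equiv s t -> ray_equiv r t.
Proof.
move=> rs st F finF.
have [C [hC rC sC]] := rs F finF; have [D [hD sD tD]] := st F finF.
exists C; split=> //.
by rewrite (component_eq hC hD (has_tail_in_meet sC sD)).
Qed.

Lemma graph_end_nonempty e : exists r, end_rays e r.
Proof. by case: e => R [r /= ->]; exists r; exact: ray_equiv_refl. Qed.

Lemma end_rays_equiv e r s : end_rays e r -> end_rays e s <-> ray_equiv r s.
Proof.
case: e => R [t /= ->] tr; split=> [ts|rs].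
  exact: ray_equiv_trans (ray_equiv_sym tr) ts.
exact: ray_equiv_trans tr rs.
Qed.

Lemma end_component_spec e F : finite_set F ->
  component F (end_component e F) /\
  forall r, end_rays e r -> has_tail_in r (end_component e F).
Proof.
move=> finF; rewrite /end_component; set P : set (set G) := [set C | _].
suff : exists C, P C by exact: (@xgetPex _ set0 P).
have [r er] := graph_end_nonempty e.
have [C hC rC] := ray_component r finF; exists C; split=> // s.
move=> /(end_rays_equiv s er).1 /(_ F finF)[D [hD rD sD]].
by rewrite (component_eq hC hD (has_tail_in_meet rC rD)).
Qed.

Lemma end_component_unique e F C : finite_set F -> component F C ->
  (forall r, end_rays e r -> has_tail_in r C) -> C = end_component e F.
Proof.
move=> finF hC eC; have [hD eD] := end_component_spec e finF.
have [r er] := graph_end_nonempty e.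
exact: component_eq hC hD (has_tail_in_meet (eC r er) (eD r er)).
Qed.

Lemma end_component_sub e F F' : finite_set F' -> F `<=` F' ->
  end_component e F' `<=` end_component e F.
Proof.
move=> finF' FF'; have finF := sub_finite_set FF' finF'.
have [hC eC] := end_component_spec e finF.
have [[CF' cC _] eC'] := end_component_spec e finF'.
have [r er] := graph_end_nonempty e.
apply: component_absorb hC _ cC (has_tail_in_meet (eC r er) (eC' r er)).
by move=> x /CF' nF'x /FF'.
Qed.

Lemma end_basic_sub e F F' : finite_set F' -> F `<=` F' ->
  end_basic e F' `<=` end_basic e F.
Proof.
move=> finF' FF' e' [r er rC]; exists r => // i.
exact: end_component_sub (rC i).
Qed.

Lemma end_openT : end_open setT.
Proof. by move=> e _; exists set0; first exact: finite_set0. Qed.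

Lemma end_openI : setI_closed end_open.
Proof.
move=> U W oU oW e [/oU[F finF FU] /oW[F' finF' FW]].
have finFF' : finite_set (F `|` F') by rewrite finite_setU.
exists (F `|` F') => // e' e'FF'; split.
  by apply: FU; apply: end_basic_sub e'FF' => // x; left.
by apply: FW; apply: end_basic_sub e'FF' => // x; right.
Qed.

Lemma end_open_bigcup (I : Type) (f : I -> set graph_end) :
  (forall i, end_open (f i)) -> end_open (\bigcup_i f i).
Proof.
move=> of_ e [i _ /(of_ i)[F finF Ff]]; exists F => // e' /Ff fe'.
by exists i.
Qed.

HB.instance Definition _ :=
  isOpenTopological.Build graph_end end_openT end_openI end_open_bigcup.

Lemma end_space_openE : open = end_open.
Proof. by []. Qed.

End EndSpace.

Definition end_space (G : graph) : topologicalType := graph_end G.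

Section CoveringProperties.
Variable X : topologicalType.

Definition open_covering (U : set (set X)) : Prop :=
  U `<=` open /\ \bigcup_(A in U) A = setT.

Definition lindelof : Prop :=
  forall U : set (set X), open_covering U ->
    exists V : set (set X),
      [/\ V `<=` U, countable V & \bigcup_(A in V) A = setT].

Definition menger : Prop :=
  forall U : nat -> set (set X), (forall n, open_covering (U n)) ->
    exists F : nat -> set (set X),
      [/\ forall n, F n `<=` U n, forall n, finite_set (F n) &
          \bigcup_n \bigcup_(A in F n) A = setT].

Definition sigma_compact : Prop :=
  exists2 K : nat -> set X, (forall n, compact (K n)) & \bigcup_n K n = setT.

End CoveringProperties.

Definition homeomorphic (X Y : topologicalType) : Prop :=
  exists (f : X -> Y) (g : Y -> X),
    [/\ continuous f, continuous g, cancel f g & cancel g f].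

Definition contains_closed_copy (X Y : topologicalType) : Prop :=
  exists2 A : set X, closed A & homeomorphic (set_type A) Y.

Definition baire_space : topologicalType := {ptws nat -> nat}.

(* Main.v *)
Require Import Defs.
From Stdlib Require Import Relations.
From mathcomp Require Import all_boot all_classical topology.

Set Implicit Arguments.
Unset Strict Implicit.
Unset Printing Implicit Defensive.

Local Open Scope classical_set_scope.

(** A sigma-compact space is Menger because each U_n has a finite subfamily
    covering the n-th compact piece.  A Menger space is Lindelof (apply the
    property to a constant sequence) and cannot contain a closed copy of
    omega^omega: finite subfamilies of the covers by open sets on which the n-th
    coordinate is bounded yield bounds k(n), and a point whose n-th coordinate
    exceeds k(n) for all n is missed ([menger_no_baire]).  These two steps hold
    in every space; the remaining one, from (c) to (a), is where the graph
    matters.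

    Call a set of ends bounded if, for every finite F, it meets only finitely
    many components of G \ F.  Every choice of components, one for each finite
    F and coherent in F, comes from an end ([direction_end]); hence the closure
    of a bounded set is compact ([bounded_compact_closure]), and it suffices to
    cover the end space by countably many bounded sets.  A region is a
    connected vertex set with finite boundary; it is good if its ends are
    covered by countably many bounded sets, and bad otherwise.  By the
    Lindelof property each G \ F has only countably many components with ends;
    so if the end space is not covered by countably many bounded sets,
    then there is a bad region.

    If every bad region falls apart, after deletion of a suitable finite set,
    into infinitely many bad regions, iterate this: it gives bad regions C_s
    for all finite sequences s of naturals and finite connected sets S_s inside
    C_s that separate the children of C_s and are linked to them.  The S_s form
    a tree-like subgraph whose part inside C_s is connected for every s.  Each
    x : nat -> nat picks a branch, each branch converges to an end e_x, and
    x |-> e_x embeds omega^omega as a closed subspace ([scheme_baire]).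

    Otherwise there is a bad region C such that for every finite F only
    finitely many bad components of G \ F lie in C, and this is
    contradictory ([finitely_bad_sigma_bounded]).  The union of two good
    regions that meet is good, so to lie in a common good region is an
    equivalence relation on the vertices of C that lie in good regions.  Each
    class O is an increasing union of good regions H_0, H_1, ..., where H_{n+1}
    swallows the boundary of H_n inside O; it exhausts O because O is covered
    by connected sets contained in O.  Let B_m be the set of ends e of C such
    that, if e lies in a good region with class O, then O has number at most m
    among the components of the complement of its boundary (if that is finite),
    and, if n is the first index for which e is an end of H_n, then e is in the
    m-th piece of some H_j with j <= n, where the pieces of H_j are an
    increasing sequence of bounded sets covering its ends.  The B_m cover the
    ends of C.  They are bounded: a good component D of G \ F in C with class O either equals O, or has a
    neighbour in O.  The former happens for finitely many D by the bound on the
    numbers.  In the latter case O is the class of one of the finitely many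
    vertices of F.  Let H_n contain the part of F in O; all but finitely many D
    then miss the finite boundary of H_n, hence lie inside H_n, where the part
    of B_m is contained in finitely many bounded pieces. *)

(** * Connected sets, boundaries and regions *)

Section Regions.
Variable G : graph.
Implicit Types (F A B C D E : set G) (r s : ray G) (e : graph_end G).

Definition boundary A : set G := [set y | ~ A y /\ exists2 x, A x & adj x y].

(** A region is a component of the complement of some finite vertex set; unlike
    a component it can be named without that set. *)
Definition region A : Prop := gconnected A /\ finite_set (boundary A).

(** For a region one ray of the end decides, by [ends_in_all]; for other vertex
    sets an end may have rays both inside and outside. *)
Definition ends_in A : set (graph_end G) :=
  [set e | exists2 r, end_rays e r & has_tail_in r A].

(** A walk leaves [A] only through its boundary. *)
Lemma connected_absorb A D : gconnected D -> D `&` A !=set0 ->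
  D `&` boundary A = set0 -> D `<=` A.
Proof.
move=> [_ cD] [x [Dx Ax]] DA0 y Dy.
have w := @clos_rt_rt1n _ _ _ _ (cD _ _ Dx Dy).
elim: w Ax => {x y Dx Dy} // u v t [Du Dv uv] _ IH Au; apply: IH.
apply: contrapT => nAv; suff : (D `&` boundary A) v by rewrite DA0.
by split=> //; split=> //; exists u.
Qed.

Lemma gconnected1 (x : G) : gconnected [set x].
Proof. by split; [exists x|move=> u v -> ->; exact: rt_refl]. Qed.

Lemma gconnected2 (x y : G) : adj x y -> gconnected [set x; y].
Proof.
move=> xy; split; first by exists x; left.
move=> u v [->|->] [->|->]; try exact: rt_refl; apply: rt_step; split=> //;
  try by [left|right].
exact: adj_sym.
Qed.

Lemma gconnectedU_adj A B x y : gconnected A -> gconnected B -> A x -> B y ->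
  adj x y -> gconnected (A `|` B).
Proof.
move=> cA cB Ax By /gconnected2 cxy.
have -> : A `|` B = (A `|` [set x; y]) `|` B.
  apply/seteqP; split=> z; first by move=> [?|?]; [left; left|right].
  by move=> [[?|[->|->]]|?]; [left|left|right|right].
apply: gconnectedU => //; last by exists y; split=> //; right; right.
by apply: gconnectedU => //; exists x; split=> //; left.
Qed.

(** The form in which unions of infinitely many connected sets are shown to be
    connected: all of them pass through one vertex [a]. *)
Lemma gconnected_star A (a : G) : A a ->
  (forall x, A x -> exists D, [/\ gconnected D, D `<=` A, D a & D x]) ->
  gconnected A.
Proof.
move=> Aa H; split; first by exists a.
move=> x y /H[D [cD DA Da Dx]] /H[E [cE EA Ea Ey]].
have c : gconnected (D `|` E) by apply: gconnectedU => //; exists a.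
have := c.2 x y (or_introl Dx) (or_intror Ey).
elim=> [u v [Du Dv uv]|u|u v w _ IH1 _ IH2].
- by apply: rt_step; split=> //; [case: Du => [/DA|/EA]|case: Dv => [/DA|/EA]].
- exact: rt_refl.
- exact: rt_trans IH1 IH2.
Qed.

Lemma finite_walk C x y : gconnected C -> C x -> C y ->
  exists P, [/\ finite_set P, gconnected P, P `<=` C, P x & P y].
Proof.
move=> [_ cC] Cx Cy; have w := @clos_rt_rt1n _ _ _ _ (cC _ _ Cx Cy).
elim: w Cx => {x y Cy} [x|x y z [_ Cy xy] _ IH] Cx.
  exists [set x]; split=> //; first exact: gconnected1.
  by move=> u ->.
have [P [fP cP PC Py Pz]] := IH Cy.
exists ([set x] `|` P); split; [| | |by left|by right].
- by rewrite finite_setU; split=> //; exact: finite_set1.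
- exact: (gconnectedU_adj (gconnected1 x) cP _ Py xy).
- by move=> u [->|/PC].
Qed.

Lemma finite_connected_hull C F a : gconnected C -> finite_set F -> F `<=` C ->
  C a -> exists P, [/\ finite_set P, gconnected P, P `<=` C, F `<=` P & P a].
Proof.
move=> cC finF FC Ca.
have H x : exists P, F x -> [/\ finite_set P, gconnected P, P `<=` C, P a & P x].
  case: (pselect (F x)) => Fx; last by exists set0.
  have [P ?] := finite_walk cC Ca (FC _ Fx).
  by exists P.
have [P HP] := choice H.
exists ([set a] `|` \bigcup_(x in F) P x); split.
- rewrite finite_setU; split; first exact: finite_set1.
  by apply: bigcup_finite => // x /HP[].
- apply: (@gconnected_star _ a); first by left.
  move=> x [->|[y Fy Px]].
    exists [set a]; split=> //; first exact: gconnected1.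
  have [fP cP PC Pa Py] := HP _ Fy.
  by exists (P y); split=> // u Pu; right; exists y.
- by move=> x [->//|[y /HP[_ _ PC _ _] /PC]].
- by move=> x Fx; right; exists x => //; have [] := HP _ Fx.
- by left.
Qed.

Lemma component_boundary F C : component F C -> boundary C `<=` F.
Proof.
move=> hC y [nCy [x Cx xy]]; apply: contrapT => nFy; apply: nCy.
have [CF _ _] := hC.
apply: (component_absorb hC _ (gconnected2 xy)); last by right.
- by move=> u [->|->] //; exact: CF.
- by exists x; split=> //; left.
Qed.

Lemma component_intro F C : gconnected C -> C `<=` ~` F -> boundary C `<=` F ->
  component F C.
Proof.
move=> cC CF bC; split=> // D DF cD CD.
apply: connected_absorb => //.
  by have [[x Cx] _] := cC; exists x; split=> //; exact: CD.
by apply/seteqP; split=> // x [/DF + /bC].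
Qed.

Lemma region_component A : region A -> component (boundary A) A.
Proof. by move=> [cA _]; apply: component_intro => // x Ax [/(_ Ax)]. Qed.

Lemma has_tailS r A B : A `<=` B -> has_tail_in r A -> has_tail_in r B.
Proof. by move=> AB [n H]; exists n => i /H/AB. Qed.

Section EndComponent.
Variables (e : graph_end G) (F : set G).
Hypothesis finF : finite_set F.

Lemma end_component_comp : component F (end_component e F).
Proof. by have [] := end_component_spec e finF. Qed.

Lemma end_component_connected : gconnected (end_component e F).
Proof. by have [] := end_component_comp. Qed.

Lemma end_component_avoids : end_component e F `<=` ~` F.
Proof. by have [] := end_component_comp. Qed.

Lemma end_component_boundary : boundary (end_component e F) `<=` F.
Proof. exact: component_boundary end_component_comp. Qed.

Lemma end_component_region : region (end_component e F).
Proof.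
split; first exact: end_component_connected.
exact: sub_finite_set end_component_boundary finF.
Qed.

Lemma end_component_tail r : end_rays e r -> has_tail_in r (end_component e F).
Proof. by have [_] := end_component_spec e finF; apply. Qed.

Lemma end_component_ends : ends_in (end_component e F) e.
Proof.
by have [r er] := graph_end_nonempty e; exists r => //; exact: end_component_tail.
Qed.

(** The component is connected and avoids the boundary of [A], and it meets [A]
    because a tail of some ray lies in both. *)
Lemma end_component_subset A : boundary A `<=` F -> ends_in A e ->
  end_component e F `<=` A.
Proof.
move=> bA [r er rA]; apply: connected_absorb; first exact: end_component_connected.
  exact: has_tail_in_meet (end_component_tail er) rA.
by apply/seteqP; split=> // x [/end_component_avoids + /bA].
Qed.

Lemma component_end_component C r : component F C -> end_rays e r ->
  has_tail_in r C -> C = end_component e F.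
Proof.
move=> hC er rC; apply: component_eq hC end_component_comp _.
exact: has_tail_in_meet rC (end_component_tail er).
Qed.

Lemma connected_subset_end_component C : gconnected C -> C `&` F = set0 ->
  C `&` end_component e F !=set0 -> C `<=` end_component e F.
Proof.
move=> cC CF0 CE; apply: component_absorb end_component_comp _ cC _.
  by move=> x Cx Fx; have : (C `&` F) x by []; rewrite CF0.
by rewrite setIC.
Qed.

End EndComponent.

Lemma region_end_component A e : region A -> ends_in A e ->
  end_component e (boundary A) = A.
Proof.
move=> rA [r er tr]; apply/esym; apply: component_end_component er tr.
  by have [] := rA.
exact: region_component.
Qed.

Lemma ends_in_all A e r : region A -> ends_in A e -> end_rays e r ->
  has_tail_in r A.
Proof.
move=> rA /(region_end_component rA) <- er; apply: end_component_tail => //.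
by have [] := rA.
Qed.

Lemma ends_in_meet A B e : region A -> ends_in A e -> ends_in B e ->
  A `&` B !=set0.
Proof.
move=> rA eA [r er rB].
exact: has_tail_in_meet (ends_in_all rA eA er) rB.
Qed.

Lemma ends_inS A B : A `<=` B -> ends_in A `<=` ends_in B.
Proof. by move=> AB e [r er rA]; exists r => //; exact: has_tailS rA. Qed.

(** A tail of a ray is a ray of the same end, so every end whose component is
    that of [e] has a ray inside this component. *)
Lemma end_basicE e F : finite_set F ->
  end_basic e F = [set e' | end_component e' F = end_component e F].
Proof.
move=> finF; apply/seteqP; split=> e' /=.
  move=> [r er rC]; apply/esym/(component_end_component finF _ er).
    exact: end_component_comp.
  by exists 0.
move=> E; have [r er] := graph_end_nonempty e'.
have [n nC] := end_component_tail finF er; rewrite E in nC.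
have inj : injective (fun i => r (n + i)) by move=> i j /ray_inj/addnI.
have ad i : adj (r (n + i)) (r (n + i.+1)) by rewrite addnS; exact: ray_adj.
exists (Ray inj ad); last by move=> i; apply: nC; rewrite leq_addr.
apply/(end_rays_equiv _ er) => F' /(ray_component r)[C hC [m mC]].
exists C; split=> //; first by exists m.
by exists m => i mi /=; apply: mC; rewrite (leq_trans mi) // leq_addl.
Qed.

Lemma end_basic_open e F : finite_set F -> end_open (end_basic e F).
Proof.
move=> finF e'; rewrite end_basicE //= => E; exists F => //.
by rewrite end_basicE // E.
Qed.

Lemma end_component_mono e e' F F' : finite_set F' -> F `<=` F' ->
  end_component e F' = end_component e' F' ->
  end_component e F = end_component e' F.
Proof.
move=> fF' FF' E; have fF := sub_finite_set FF' fF'.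
apply: (component_eq (end_component_comp e fF) (end_component_comp e' fF)).
have [[x Cx] _] := end_component_connected e fF'.
by exists x; split; [|rewrite E in Cx]; exact: end_component_sub Cx.
Qed.

(** End spaces are Hausdorff, in the form used for identifying limit points. *)
Lemma end_eqP e e' :
  (forall F, finite_set F -> end_component e F = end_component e' F) -> e = e'.
Proof.
move=> H; suff R : end_rays e = end_rays e'.
  case: e e' R {H} => R p [R' p'] /= RR'; subst R'.
  by rewrite (Prop_irrelevance p p').
have [r er] := graph_end_nonempty e; have [r' er'] := graph_end_nonempty e'.
have rr' : ray_equiv r r'.
  move=> F fF; exists (end_component e F).
  split; [exact: end_component_comp|exact: end_component_tail|].
  by rewrite H //; exact: end_component_tail.
apply/seteqP; split=> s.
  move=> /(end_rays_equiv s er).1 rs; apply/(end_rays_equiv s er').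
  exact: ray_equiv_trans (ray_equiv_sym rr') rs.
move=> /(end_rays_equiv s er').1 rs; apply/(end_rays_equiv s er).
exact: ray_equiv_trans rr' rs.
Qed.

Definition end_of_ray r : graph_end G :=
  GraphEnd (ex_intro (fun s => ray_equiv r = ray_equiv s) r erefl).

Lemma end_of_ray_rays r : end_rays (end_of_ray r) r.
Proof. exact: ray_equiv_refl. Qed.

End Regions.

Lemma finite_bound (T : Type) (A : set T) (N : T -> nat) : finite_set A ->
  exists n, forall x, A x -> N x <= n.
Proof.
move=> finA; have /finite_seqP[s sE] : finite_set (N @` A) by exact: finite_image.
exists (\max_(i <- s) i) => x Ax; have : (N @` A) (N x) by exists x.
by rewrite sE /= => Ns; exact: (@leq_bigmax_seq _ _ predT id).
Qed.

(** * Rays along decreasing chains of connected sets *)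

Section RayThrough.
Variables (G : graph) (A : nat -> set G).
Hypothesis cA : forall n, gconnected (A n).
Hypothesis decA : forall n, A n.+1 `<=` A n.
Hypothesis emptyA : forall x, exists n, ~ A n x.

(** The bound [k] on the number of steps makes the distance from [x] to the next
    set of the chain available as a least value of [k]. *)
Fixpoint reach n k x : Prop :=
  A n x /\ (A n.+1 x \/
    if k is k'.+1 then exists2 y, adj x y & reach n k' y else False).

Lemma reachP n k x : reach n k x <-> A n x /\ (A n.+1 x \/
  if k is k'.+1 then exists2 y, adj x y & reach n k' y else False).
Proof. by case: k. Qed.

Lemma chain_subset m n : m <= n -> A n `<=` A m.
Proof.
by move=> /subnKC <-; elim: (n - m) => [|k IH] x; rewrite ?addn0 ?addnS // => /decA/IH.
Qed.

Lemma level_exists x : A 0 x -> exists n, A n x /\ ~ A n.+1 x.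
Proof.
move=> A0; have [n] := emptyA x; elim: n => // n IH nA.
by case: (pselect (A n x)) => [?|/IH //]; exists n.
Qed.

Lemma reach_exists n x : A n x -> exists k, reach n k x.
Proof.
have [[z Az] _] := cA n.+1; have [_ cn] := cA n => Ax.
have w := @clos_rt_rt1n _ _ _ _ (cn _ _ Ax (decA Az)).
elim: w Az {Ax} => {x z} [x|x y z [Ax Ay xy] _ IH] Az.
  by exists 0; split; [exact: decA|left].
have [k Hk] := IH Az; exists k.+1; split=> //; right.
by exists y.
Qed.

(** Give a vertex the level [l x], the last [n] with [A n x], and the distance
    [d x] to the next set of the chain.  As long as one moves to a neighbour at
    a smaller distance or a higher level, no vertex repeats, and the level must
    grow beyond all bounds since distances cannot decrease forever. *)
Lemma ray_through_chain : exists r : ray G, forall n, has_tail_in r (A n).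
Proof.
have Hl x : exists n, A 0 x -> A n x /\ ~ A n.+1 x.
  case: (pselect (A 0 x)) => [/level_exists[n ?]|]; first by exists n.
  by exists 0.
have {Hl}[l Hl] := choice Hl.
have lP x m : A 0 x -> A m x -> m <= l x.
  move=> /Hl[_ nA] Am; rewrite leqNgt; apply/negP => /chain_subset/(_ _ Am).
  exact: nA.
have Hd x : exists k, A 0 x -> reach (l x) k x /\ forall j, reach (l x) j x -> k <= j.
  case: (pselect (A 0 x)) => Ax; last by exists 0.
  have ex : exists k, `[< reach (l x) k x >].
    by have [k ?] := reach_exists (Hl _ Ax).1; exists k; apply/asboolP.
  exists (ex_minn ex); case: ex_minnP => k /asboolP Hk mk; split=> // j Hj.
  by apply: mk; apply/asboolP.
have {Hd}[d Hd] := choice Hd.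
pose lt x y := l x < l y \/ (l x = l y /\ d y < d x).
have lt_trans x y z : lt x y -> lt y z -> lt x z.
  rewrite /lt => -[xy|[-> xy]] [yz|[<- yz]]; [left|left|by left|right].
  - exact: ltn_trans xy yz.
  - by [].
  - by split=> //; exact: ltn_trans yz xy.
have step x : exists y, A 0 x -> [/\ adj x y, A 0 y & lt x y].
  case: (pselect (A 0 x)) => Ax; last by exists x.
  have [+ _] := Hd _ Ax; move: (erefl (d x)); case: {2 3}(d x) => [|k] E;
    move=> /reachP[Alx [/(Hl _ Ax).2 //|]] => //.
  move=> [y xy ry]; exists y => _.
  have Aly : A (l x) y by move/reachP: ry => [].
  have A0y : A 0 y by exact: (chain_subset (leq0n (l x))).
  split=> //; have := lP _ _ A0y Aly; rewrite leq_eqVlt => /orP[/eqP lxy|]; last by left.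
  right; split=> //; rewrite E ltnS; apply: (Hd _ A0y).2; by rewrite -lxy.
have {step}[nxt Hn] := choice step.
have [[x0 Ax0] _] := cA 0.
pose f i := iter i nxt x0.
have Af i : A 0 (f i) by elim: i => // i IH; have [] := Hn _ IH.
have ltS i : lt (f i) (f i.+1) by have [] := Hn _ (Af i).
have ltf i j : i < j -> lt (f i) (f j).
  elim: j => // j IH; rewrite ltnS leq_eqVlt => /orP[/eqP->//|/IH ij].
  exact: lt_trans ij (ltS j).
have inj : injective f.
  have irr x : ~ lt x x by rewrite /lt !ltnn => -[|[]].
  by move=> i j E; case: (ltngtP i j) => // /ltf; rewrite E => /irr.
have ad i : adj (f i) (f i.+1) by have [] := Hn _ (Af i).
exists (Ray inj ad) => n.
have lm i j : i <= j -> l (f i) <= l (f j).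
  by rewrite leq_eqVlt => /orP[/eqP->//|/ltf[/ltnW|[->]]].
suff [i ni] : exists i, n <= l (f i).
  exists i => j ij /=; apply: (chain_subset (leq_trans ni (lm _ _ ij))).
  exact: (Hl _ (Af j)).1.
elim: n => [|n [i ni]]; first by exists 0.
have [k dk] : exists k, d (f i) <= k by exists (d (f i)).
elim: k i ni dk => [|k IH] i ni dk; case: (ltS i) => [lt1|[le1 lt1]].
- by exists i.+1; exact: leq_ltn_trans lt1.
- by have := leq_trans lt1 dk.
- by exists i.+1; exact: leq_ltn_trans lt1.
- by apply: (IH i.+1); [rewrite -le1|rewrite -ltnS; exact: leq_trans dk].
Qed.

End RayThrough.

Section EndOfChain.
Variables (G : graph) (A : nat -> set G).
Hypothesis cA : forall n, gconnected (A n).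
Hypothesis decA : forall n, A n.+1 `<=` A n.
Hypothesis emptyA : forall x, exists n, ~ A n x.

Lemma chain_avoids (F : set G) : finite_set F ->
  exists n, forall m, n <= m -> A m `&` F = set0.
Proof.
move=> finF; have [N HN] := choice emptyA.
have [n Hn] := finite_bound N finF; exists n => m nm; apply/seteqP; split=> // x [Am Fx].
by apply: (HN x); apply: chain_subset decA _ _ _ _ Am; exact: leq_trans (Hn _ Fx) nm.
Qed.

Lemma end_of_chain : exists e : graph_end G,
  forall n, ends_in (A n) e.
Proof.
have [r rA] := ray_through_chain cA decA emptyA.
by exists (end_of_ray r) => n; exists r; [exact: end_of_ray_rays|exact: rA].
Qed.

(** From some point on the connected sets avoid [F], so each lies on one side
    of it, namely on the side of the tails of [e]. *)
Lemma chain_end_component e (F : set G) : finite_set F -> (forall n, ends_in (A n) e) ->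
  exists n, forall m, n <= m -> A m `<=` end_component e F.
Proof.
move=> finF eA; have [n Hn] := chain_avoids finF; exists n => m nm.
apply: connected_subset_end_component => //; first exact: Hn.
have [r er rA] := eA m.
exact: has_tail_in_meet rA (end_component_tail finF er).
Qed.

End EndOfChain.

(** * Directions and ends *)

Section Directions.
Variables (G : graph) (f : set G -> set G).
Hypothesis fC : forall F, finite_set F -> component F (f F).
Hypothesis fS : forall F F', finite_set F' -> F `<=` F' -> f F' `<=` f F.

(** The vertices that dominate the end to be found. *)
Let dominating : set G := [set v | forall F, finite_set F -> ~ F v -> f F v].

(** Both cases below produce a chain to which a ray can be fitted; the last
    hypothesis makes the components chosen by the direction follow it. *)
Lemma direction_of_chain (A : nat -> set G) :
  (forall n, gconnected (A n)) -> (forall n, A n.+1 `<=` A n) ->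
  (forall x, exists n, ~ A n x) ->
  (forall F n, finite_set F -> A n `&` F = set0 -> A n `&` f F !=set0) ->
  exists e : graph_end G, forall F, finite_set F -> end_component e F = f F.
Proof.
move=> cA decA eA Af; have [e He] := end_of_chain cA decA eA.
exists e => F finF; apply: component_eq (end_component_comp e finF) (fC finF) _.
have [n Hn] := chain_avoids decA eA finF.
have [m Hm] := chain_end_component cA decA eA finF He.
pose k := maxn n m.
have [x [Ax fx]] := Af _ _ finF (Hn _ (leq_maxl n m)).
by exists x; split=> //; apply: Hm Ax; exact: leq_maxr.
Qed.

Lemma direction_connected F : finite_set F -> gconnected (f F).
Proof. by move=> /fC[]. Qed.

Lemma direction_avoids F : finite_set F -> f F `<=` ~` F.
Proof. by move=> /fC[]. Qed.

(** Join dominating vertices one after the other by finite connected sets, each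
    of which avoids the earlier ones apart from its starting vertex.  This is
    possible since no finite set separates two dominating vertices.  The tails
    of this string of connected sets form the chain. *)
Lemma direction_infinite : infinite_set dominating ->
  exists e : graph_end G, forall F, finite_set F -> end_component e F = f F.
Proof.
move=> infD.
have freshD Z : finite_set Z -> exists2 d, dominating d & ~ Z d.
  move=> finZ; apply: contrapT => H; apply: infD.
  apply: sub_finite_set finZ => d Dd; apply: contrapT => nZ; apply: H.
  by exists d.
(* A state consists of the vertices used so far and the last dominating one. *)
pose ok (p : set G * G) := [/\ finite_set p.1, p.1 p.2 & dominating p.2].
pose next (p q : set G * G) := [/\ ok q, p.1 `<=` q.1, ~ p.1 q.2 &
  exists P, [/\ gconnected P, P p.2, P q.2, P `<=` ~` (p.1 `\ p.2) & q.1 = p.1 `|` P]].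
have step p : exists q, ok p -> next p q.
  case: (pselect (ok p)) => [okp|]; last by exists p.
  have [fp p12 Dp] := okp.
  have [d Dd nd] := freshD _ fp.
  have fp' : finite_set (p.1 `\ p.2) by exact: finite_setD.
  have f1 : f (p.1 `\ p.2) p.2 by apply: Dp => //; case=> _; apply.
  have f2 : f (p.1 `\ p.2) d by apply: Dd => //; case.
  have [P [fP cP PC P1 P2]] := finite_walk (direction_connected fp') f1 f2.
  exists (p.1 `|` P, d) => _; split=> //=; first 1 last.
  - exists P; split=> //; exact: subset_trans (direction_avoids fp').
  - by split=> //=; [rewrite finite_setU|right].
have [nxt Hn] := choice step.
have [d0 Dd0 _] := freshD _ (@finite_set0 G).
pose s i := iter i nxt ([set d0], d0).
have oks i : ok (s i).
  by elim: i => [|i /Hn[]//]; split=> //; exact: finite_set1.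
have Hs i : next (s i) (s i.+1) by exact: Hn.
have {}Hs i := Hs i.
have HP i : exists P, [/\ gconnected P, P (s i).2, P (s i.+1).2,
    P `<=` ~` ((s i).1 `\ (s i).2) & (s i.+1).1 = (s i).1 `|` P].
  by have [] := Hs i.
have {HP}[P HP] := choice HP.
have smono i j : i <= j -> (s i).1 `<=` (s j).1.
  move=> /subnKC <-; elim: (j - i) => [|k IH]; rewrite ?addn0 ?addnS // => x /IH.
  by have [_ + _ _] := Hs (i + k); apply.
pose A n := \bigcup_(i in [set i | n <= i]) P i.
have sA n i : n <= i -> A n (s i).2.
  by move=> ni; exists i => //; have [] := HP i.
apply: (@direction_of_chain A).
- move=> n; apply: (@gconnected_star _ _ (s n).2); first exact: sA.
  have H i : n <= i -> exists D, [/\ gconnected D, D `<=` A n, D (s n).2, D (s i).2 & P i `<=` D].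
    move=> /subnKC <-; elim: (i - n) => [|k [D [cD DA Dn Di _]]].
      rewrite addn0; have [cP P1 _ _ _] := HP n; exists (P n); split=> //.
      by move=> x Px; exists n => //=.
    have [cP P1 P2 _ _] := HP (n + k); have [cP' P1' _ _ _] := HP (n + k).+1.
    have DP : gconnected (D `|` P (n + k)) by apply: gconnectedU => //; exists (s (n + k)).2.
    have PA j : n <= j -> P j `<=` A n by move=> nj x Px; exists j.
    exists (D `|` P (n + k) `|` P (n + k).+1); rewrite addnS; split.
    + by apply: gconnectedU => //; exists (s (n + k).+1).2; split=> //; right.
    + by move=> x [[/DA//|]|]; apply: PA; rewrite ?leq_addr // -addnS leq_addr.
    + by left; left.
    + by right.
    + by move=> x; right.
  by move=> x [i ni Pi]; have [D [? ? ? ? PD]] := H i ni; exists D; split=> //; exact: PD.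
- by move=> n x [i /= /ltnW ni Pi]; exists i.
- move=> x; case: (pselect (exists i, (s i).1 x)) => [[i six]|nx]; last first.
    exists 0 => -[i _ Pi]; apply: nx; exists i.+1; have [_ _ _ _ ->] := HP i.
    by right.
  exists i.+1 => -[j /= ij Pj]; have [_ _ _ avoid _] := HP j.
  have := avoid _ Pj; apply; split; first exact: smono (ltnW ij) _ six.
  move=> xE; move: (ij); case: j ij xE {Pj avoid} => // j ij xE _.
  have [_ _ + _] := Hs j; apply; rewrite -xE.
  by apply: smono six.
- move=> F n finF AF; exists (s n).2; split; first exact: sA.
  have [_ _ Dn] := oks n; apply: Dn => // Fs.
  have : (A n `&` F) (s n).2 by split=> //; exact: sA.
  by rewrite AF.
Qed.

(** Start with the dominating vertices and, at each stage, add for every other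
    vertex [v] present a finite set that separates [v] from the direction.  Then
    a boundary vertex of the next component that was already present is
    dominating.  Hence the boundary of the intersection of the components
    consists of dominating vertices only; if it were nonempty, it would contain
    the component [f D], which is impossible as a vertex [v0] of [f D] has been
    deleted. *)
Lemma direction_finite : finite_set dominating ->
  exists e : graph_end G, forall F, finite_set F -> end_component e F = f F.
Proof.
move=> finD; set D := dominating in finD *.
have HS v : exists F, ~ D v -> [/\ finite_set F, ~ F v & ~ f F v].
  case: (pselect (D v)) => Dv; first by exists set0.
  move: (Dv) => /existsNP[F /not_implyP[fF /not_implyP[? ?]]].
  by exists F.
have {HS}[S HS] := choice HS.
have [[v0 fv0] _] := direction_connected finD.
pose nxt F := F `|` \bigcup_(v in F `\` D) S v.
pose Fs n := iter n nxt (D `|` [set v0]).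
have fFs n : finite_set (Fs n).
  elim: n => [|n IH] /=; first by rewrite finite_setU; split=> //; exact: finite_set1.
  rewrite /nxt finite_setU; split=> //; apply: bigcup_finite; first exact: finite_setD.
  by move=> v [_ /HS[]].
have incF n : Fs n `<=` Fs n.+1 by move=> x; left.
have DF n : D `<=` Fs n by elim: n => [|n IH] x Dx; left=> //; exact: IH.
have key n : boundary (f (Fs n.+1)) `&` Fs n `<=` D.
  move=> v [[nv [w fw wv]] Fv]; apply: contrapT => nD.
  have [fS' nS nf] := HS _ nD; apply: nf.
  have SF : S v `<=` Fs n.+1 by move=> x Sx; right; exists v.
  have fw' := fS (fFs n.+1) SF fw.
  apply: contrapT => nfv; apply: nS.
  by apply: (component_boundary (fC fS')); split=> //; exists w.
apply: (@direction_of_chain (fun n => f (Fs n))).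
- by move=> n; exact: direction_connected.
- by move=> n; exact: fS.
- move=> x; apply: contrapT => /forallNP Hx.
  pose I := \bigcap_n f (Fs n).
  have Ix : I x by move=> n _; apply: contrapT; exact: Hx.
  have bI : boundary I `<=` D.
    move=> z [/existsNP[n /not_implyP[_ nz]] [w Iw wz]].
    have Fz m : n <= m -> boundary (f (Fs m)) z.
      move=> nm; split; last by exists w => //; exact: Iw.
      apply: contra_not nz; move: nm => /subnKC <-.
      by elim: (m - n) => [|k IH]; rewrite ?addn0 ?addnS // => /fS/IH; apply.
    apply: (key n); split; first exact: Fz.
    by apply: (component_boundary (fC (fFs n))); exact: Fz.
  have fI : f D `<=` I.
    apply: connected_absorb; first exact: direction_connected.
    - exists x; split=> //.
      by apply: (fS (fFs 0)); [exact: DF|exact: Ix].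
    - by apply/seteqP; split=> // z [/(direction_avoids finD) + /bI].
  by have /(direction_avoids (fFs 0)) := fI _ fv0 0 Logic.I; apply; right.
- move=> F n finF _.
  have fU : finite_set (F `|` Fs n) by rewrite finite_setU.
  have [[z fz] _] := direction_connected fU; exists z.
  by split; apply: fS fz.
Qed.

(** The theorem of Diestel and Kuehn that directions come from ends. *)
Theorem direction_end :
  exists e : graph_end G, forall F, finite_set F -> end_component e F = f F.
Proof.
by case: (pselect (finite_set dominating)) => [/direction_finite|/direction_infinite].
Qed.

End Directions.

(** * Bounded sets of ends and compactness *)

Section Bounded.
Variable G : graph.
Implicit Types (A B : set (graph_end G)) (F : set G) (e : graph_end G).

Lemma nbhs_endP e A :
  nbhs e A <-> exists2 F, finite_set F & end_basic e F `<=` A.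
Proof.
rewrite nbhsE; split=> [[U [oU Ue] UA]|[F finF FA]].
  have [F finF FU] := oU e Ue.
  by exists F => //; exact: subset_trans UA.
exists (end_basic e F) => //; split; first exact: end_basic_open.
by rewrite end_basicE.
Qed.

Lemma closure_endP A e : closure A e <->
  forall F, finite_set F -> exists2 a, A a & end_component a F = end_component e F.
Proof.
split=> [cA F finF|H V /nbhs_endP[F finF FV]].
  have /cA[a [Aa]] : nbhs e (end_basic e F) by apply/nbhs_endP; exists F.
  by rewrite end_basicE // => ea; exists a.
have [a Aa ea] := H F finF; exists a; split=> //; apply: FV.
by rewrite end_basicE.
Qed.

Definition bounded B : Prop :=
  forall F, finite_set F -> finite_set ((fun e => end_component e F) @` B).

Definition sigma_bounded A : Prop :=
  exists2 K : nat -> set (graph_end G),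
    forall n, bounded (K n) & A `<=` \bigcup_n K n.

Lemma bounded0 : bounded set0.
Proof. by move=> F finF; rewrite image_set0. Qed.

Lemma bounded_bigcup (I : Type) (D : set I) (K : I -> set (graph_end G)) :
  finite_set D -> (forall i, D i -> bounded (K i)) ->
  bounded (\bigcup_(i in D) K i).
Proof.
move=> finD bK F finF; rewrite image_bigcup; apply: bigcup_finite => // i Di.
exact: bK.
Qed.

(** A component of the complement of a larger set determines the one of a
    smaller set, so boundedness need only be tested on large finite sets. *)
Lemma bounded_superset A F0 : finite_set F0 ->
  (forall F, finite_set F -> F0 `<=` F ->
     finite_set ((fun e => end_component e F) @` A)) -> bounded A.
Proof.
move=> fF0 H F finF; have fU : finite_set (F `|` F0) by rewrite finite_setU.
have [g Hg] : exists g : set G -> set G, forall e,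
    A e -> end_component e F = g (end_component e (F `|` F0)).
  have : forall C, exists D, forall e, A e -> end_component e (F `|` F0) = C ->
      end_component e F = D.
    move=> C; case: (pselect (exists2 e, A e & end_component e (F `|` F0) = C)).
      move=> [e Ae <-]; exists (end_component e F) => e' Ae'.
      by apply: end_component_mono => // x; left.
    by move=> nC; exists set0 => e Ae eC; case: nC; exists e.
  by move=> /choice[g Hg]; exists g => e Ae; exact: Hg.
apply: (@sub_finite_set _ _
  (g @` ((fun e => end_component e (F `|` F0)) @` A))).
  move=> _ [e Ae <-]; exists (end_component e (F `|` F0)); last by rewrite -Hg.
  by exists e.
by apply: finite_image; apply: H => // x; right.
Qed.

Lemma sigma_boundedS A B : A `<=` B -> sigma_bounded B -> sigma_bounded A.
Proof. by move=> AB [K bK BK]; exists K => //; exact: subset_trans BK. Qed.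

(** The pieces are indexed by codes of pairs; the inner union over an index [i]
    with [f i = n] has at most one member. *)
Lemma sigma_bounded_bigcup (I : Type) (D : set I) (A : I -> set (graph_end G)) :
  countable D -> (forall i, D i -> sigma_bounded (A i)) ->
  sigma_bounded (\bigcup_(i in D) A i).
Proof.
move=> /countable_injP[f injf] H.
have HK i : exists K : nat -> set (graph_end G), D i ->
    (forall n, bounded (K n)) /\ A i `<=` \bigcup_n K n.
  case: (pselect (D i)) => [/H[K ? ?]|]; first by exists K.
  by exists (fun=> set0).
have {HK}[K HK] := choice HK.
pose N k := if unpickle k is Some (n, m) then
  \bigcup_(i in [set i | D i /\ f i = n]) K i m else set0.
exists N => [k|e [i Di Ae]].
  rewrite /N; case: (unpickle k) => [[n m]|]; last exact: bounded0.
  apply: bounded_bigcup => [|i [Di _]]; last by have [] := HK i Di.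
  case: (pselect (exists i, D i /\ f i = n)) => [[i [Di fi]]|nD].
    apply: (@sub_finite_set _ _ [set i]); last exact: finite_set1.
    by move=> j [Dj fj]; apply: injf; rewrite ?inE // fj.
  by apply: (@sub_finite_set _ _ set0) => // j Dj; case: nD; exists j.
have [_ /(_ _ Ae)[m _ Kem]] := HK i Di.
by exists (pickle (f i, m)) => //; rewrite /N pickleK; exists i.
Qed.

Lemma sigma_bounded_increasing A : sigma_bounded A ->
  exists K : nat -> set (graph_end G), [/\ forall n, bounded (K n),
    forall m n, m <= n -> K m `<=` K n & A `<=` \bigcup_n K n].
Proof.
move=> [K bK AK]; exists (fun n => \bigcup_(i in [set i | i <= n]) K i); split.
- move=> n; apply: bounded_bigcup => //.
  by apply: (@sub_finite_set _ _ `I_n.+1).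
- by move=> m n mn e [i /= im Ke]; exists i => //=; exact: leq_trans mn.
- by move=> e /AK[n _ Ke]; exists n => //; exists n => /=.
Qed.

Lemma ultra_finite_fiber (T : Type) (C : choiceType) (U : set_system T)
    (h : T -> C) (B : set T) : UltraFilter U -> U B -> finite_set (h @` B) ->
  exists c, U [set x | h x = c].
Proof.
move=> UU UB /finite_seqP[s Bs]; apply: contrapT => /forallNP nU.
have U1 c : U [set x | h x <> c].
  by have [/nU//|] := in_ultra_setVsetC [set x | h x = c] UU.
have : U (B `&` [set x | h x \notin s]).
  apply: filterI => //; elim: s {Bs} => [|c s IH]; first exact: filterS filterT.
  apply: filterS (filterI (U1 c) IH) => x [hc hs] /=.
  by rewrite inE negb_or; apply/andP; split=> //; apply/eqP.
move=> /filter_ex[x [Bx /negP]]; apply.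
have : (h @` B) (h x) by exists x.
by rewrite Bs.
Qed.

(** An ultrafilter containing [closure B] selects one component of [G \ F] for
    each finite [F], because only finitely many occur.  These form a direction,
    and the end it comes from is the limit. *)
Lemma bounded_compact_closure B : bounded B -> compact (closure B).
Proof.
move=> bB; rewrite compact_ultra => U UU UB.
have Hf F : exists C, finite_set F -> U [set e | end_component e F = C].
  case: (pselect (finite_set F)) => finF; last by exists set0.
  have /(ultra_finite_fiber UU UB)[C HC] :
      finite_set ((fun e => end_component e F) @` closure B).
    apply: sub_finite_set (bB F finF) => _ [e /closure_endP/(_ F finF)[b Bb <-] <-].
    by exists b.
  by exists C.
have {Hf}[f Hf] := choice Hf.
have [e He] : exists e : graph_end G, forall F, finite_set F -> end_component e F = f F.
  apply: direction_end => [F finF|F F' finF' FF'].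
    by have /filter_ex[e /= <-] := Hf F finF; exact: end_component_comp.
  have finF := sub_finite_set FF' finF'.
  have [e [/= <- <-]] := filter_ex (filterI (Hf F finF) (Hf F' finF')).
  exact: end_component_sub.
exists e; split.
  apply/closure_endP => F finF.
  have [e' [/= + E]] := filter_ex (filterI UB (Hf F finF)).
  move=> /closure_endP/(_ F finF)[b Bb be]; exists b => //.
  by rewrite be E He.
move=> V /nbhs_endP[F finF FV]; apply: filterS FV _.
by rewrite end_basicE //; rewrite He //; exact: Hf.
Qed.

Lemma sigma_bounded_sigma_compact :
  sigma_bounded setT -> sigma_compact (end_space G).
Proof.
move=> [K bK TK]; exists (fun n => closure (K n)).
  by move=> n; exact: bounded_compact_closure.
apply/seteqP; split=> // e /TK[n _ Ke]; exists n => //.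
exact: subset_closure.
Qed.

End Bounded.

(** * Regions with finitely many bad components are good *)

Section FiniteBranching.

Lemma finite_powerset (T : Type) (F : set T) : finite_set F ->
  finite_set [set A | A `<=` F].
Proof.
elim/Pchoice: T F => T F /finite_seqP[s ->]; elim: s => [|x s IH].
  apply: (@sub_finite_set _ _ [set set0]); last exact: finite_set1.
  by move=> A As; apply/seteqP; split=> // x /As.
apply: (@sub_finite_set _ _ ([set A | A `<=` [set` s]] `|`
    [set x |` A | A in [set A | A `<=` [set` s]]])); last first.
  by rewrite finite_setU; split=> //; exact: finite_image.
move=> A As; case: (pselect (A x)) => Ax; [right|left].
  exists (A `\ x); last exact: setD1K.
  by move=> y [/As/=]; rewrite inE => /orP[/eqP|].
move=> y Ay; have := As _ Ay; rewrite /= inE => /orP[/eqP yx|//].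
by rewrite yx in Ay.
Qed.

Variable G : graph.
Implicit Types (A B C D E F O : set G) (e : graph_end G).

Lemma lindelof_countable_components : lindelof (end_space G) ->
  forall F, finite_set F -> countable ((fun e => end_component e F) @` setT).
Proof.
move=> L F finF.
have [|V [VU cV VT]] := L [set end_basic e F | e in setT].
  split; last by apply/seteqP; split=> // e _; exists (end_basic e F);
    [exists e|rewrite end_basicE].
  by move=> _ [e _ <-]; exact: end_basic_open.
pose g (W : set (graph_end G)) : set G := \bigcup_(e in W) end_component e F.
apply: (@sub_countable _ _ _ (g @` V)); last exact: (sub_countable (card_image_le _ _) cV).
apply: subset_card_le => _ [e _ <-].
have : [set: end_space G] e by [].
rewrite -VT => -[W VW We]; exists W => //.
have [e' _ We'] := VU _ VW; move: We; rewrite -We' end_basicE //= => ee'.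
apply/seteqP; split=> x; first by move=> [e'' /= -> ]; rewrite ee'.
by move=> Cx; exists e.
Qed.

(** Once the finitely many boundaries are deleted, a component that meets the
    union lies in one of the regions. *)
Lemma ends_in_bigcup (I : Type) (J : set I) (A : I -> set G) :
  finite_set J -> (forall i, J i -> region (A i)) ->
  ends_in (\bigcup_(i in J) A i) `<=` \bigcup_(i in J) ends_in (A i).
Proof.
move=> finJ rA e [r er rU].
pose F := \bigcup_(i in J) boundary (A i).
have finF : finite_set F by apply: bigcup_finite => // i /rA[].
have [x [Cx [i Ji Ax]]] := has_tail_in_meet (end_component_tail finF er) rU.
exists i => //; exists r => //; apply: has_tailS (end_component_tail finF er).
apply: connected_absorb; first exact: end_component_connected.
  by exists x.
apply/seteqP; split=> // y [/(end_component_avoids finF) nF bA].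
by apply: nF; exists i.
Qed.

Variable C : set G.
Hypothesis rC : region C.
Hypothesis countC :
  forall F, finite_set F -> countable ((fun e => end_component e F) @` setT).
Hypothesis finitelyBad : forall F, finite_set F -> boundary C `<=` F ->
  finite_set [set D | exists e, [/\ ends_in C e, D = end_component e F &
                                   ~ sigma_bounded (ends_in D)]].

Let good E := [/\ region E, E `<=` C & sigma_bounded (ends_in E)].

(** On vertices in good regions this is the equivalence class for lying in a
    common good region; for other vertices it is empty. *)
Let cls x : set G := \bigcup_(E in [set E | good E /\ E x]) E.

Lemma good_bigcup (S : set (set G)) x : finite_set S -> S !=set0 ->
  (forall E, S E -> good E /\ E x) -> good (\bigcup_(E in S) E).
Proof.
move=> finS [E0 SE0] gS; split.
- split.
    apply: (@gconnected_star _ _ x); first by exists E0 => //; have [] := gS _ SE0.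
    move=> y [E SE Ey]; have [[[cE _] _ _] Ex] := gS _ SE.
    by exists E; split=> // z Ez; exists E.
  apply: (@sub_finite_set _ _ (\bigcup_(E in S) boundary E)).
    move=> y [nU [z [E SE Ez] zy]]; exists E => //; split; last by exists z.
    by move=> Ey; apply: nU; exists E.
  by apply: bigcup_finite => // E /gS[[[]]].
- by move=> y [E /gS[[_ EC _] _] /EC].
- apply: (@sigma_boundedS _ _ (\bigcup_(E in S) ends_in E)).
    by apply: ends_in_bigcup => // E /gS[[]].
  apply: sigma_bounded_bigcup; first exact: finite_set_countable.
  by move=> E /gS[[]].
Qed.

Lemma cls_eq x y : cls x y -> cls x = cls y.
Proof.
have H u v : cls u v -> cls v `<=` cls u.
  move=> [E [gE Eu] Ev] w [E' [gE' E'v] E'w].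
  exists (\bigcup_(D in [set E; E']) D); last by exists E' => //; right.
  split; last by exists E => //; left.
  apply: (@good_bigcup _ v); first exact: finite_set2.
    by exists E; left.
  by move=> D [->|->].
move=> xy; apply/seteqP; split; apply: H => //.
by have [E [gE Ex] Ey] := xy; exists E.
Qed.

Lemma good_cls x E : good E -> E x -> E `<=` cls x.
Proof. by move=> gE Ex y Ey; exists E. Qed.

(** Each step adds, for every boundary vertex inside the class, a good region
    that contains it and [x].  A vertex of the class outside all [H n] would be
    joined to [x] within a good region, hence within the class, and the path
    would leave the union at a vertex that has been added. *)
Lemma cls_exhaustion x : cls x x ->
  exists H : nat -> set G, [/\ forall n, good (H n),
    forall m n, m <= n -> H m `<=` H n & cls x = \bigcup_n H n].
Proof.
move=> [E0 [gE0 E0x] _].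
have step E : exists E', good E /\ E x ->
    [/\ good E' /\ E' x, E `<=` E' & boundary E `&` cls x `<=` E'].
  case: (pselect (good E /\ E x)) => [[gE Ex]|]; last by exists E.
  have ch y : exists D, cls x y -> [/\ good D, D x & D y].
    case: (pselect (cls x y)) => [[D [gD Dx] Dy]|]; first by exists D.
    by exists set0.
  have [D HD] := choice ch.
  pose S := E |` (D @` (boundary E `&` cls x)).
  have SE : S E by left.
  have SP A : S A -> good A /\ A x.
    by move=> [->//|[y [_ xy] <-]]; have [] := HD y xy.
  have finB : finite_set (boundary E) by have [[]] := gE.
  exists (\bigcup_(A in S) A) => _; split.
  - split; last by exists E.
    apply: (@good_bigcup _ x); [|by exists E|exact: SP].
    rewrite finite_setU; split; first exact: finite_set1.
    exact: finite_image (finite_setIl _ finB).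
  - by move=> y Ey; exists E.
  - move=> y [By xy]; exists (D y); last by have [] := HD y xy.
    by right; exists y.
have [nxt Hn] := choice step.
pose H n := iter n nxt E0.
have gH n : good (H n) /\ H n x by elim: n => // n IH; have [] := Hn _ IH.
have mH m n : m <= n -> H m `<=` H n.
  move=> /subnKC <-; elim: (n - m) => [|k IH] y; rewrite ?addn0 ?addnS //.
  by move=> /IH Hy; have [_ + _] := Hn _ (gH (m + k)); apply.
exists H; split=> //; first by move=> n; have [] := gH n.
apply/seteqP; split=> y; last first.
  by move=> [n _ Hy]; exists (H n) => //; exact: gH.
move=> [E [gE Ex] Ey]; have [[cE _] _ _] := gE.
apply: (@connected_absorb _ (\bigcup_n H n) E cE _ _ y Ey).
  by exists x; split=> //; exists 0 => //; exact: (gH 0).2.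
apply/seteqP; split=> // z [Ez [nz [w [n _ Hw] wz]]]; apply: (nz).
exists n.+1 => //; have [_ _] := Hn _ (gH n); apply.
split; last by exists E.
split; last by exists w.
by move=> Hz; apply: nz; exists n.
Qed.

(** Good regions are connected and contained in the class, so they cannot cross
    the boundary of [D]. *)
Lemma cls_isolated x D : good D -> D x -> boundary D `&` cls x = set0 -> cls x = D.
Proof.
move=> gD Dx bD; apply/seteqP; split; last exact: good_cls.
move=> y [E [gE Ex] Ey]; have [[cE _] _ _] := gE.
apply: (@connected_absorb _ D E cE _ _ y Ey).
  by exists x.
apply/seteqP; split=> // z [Ez bz].
have : (boundary D `&` cls x) z by split=> //; exists E.
by rewrite bD.
Qed.

Lemma finite_components_meeting F (B : set G) : finite_set B ->
  finite_set [set D | component F D /\ D `&` B !=set0].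
Proof.
move=> finB; apply: (@sub_finite_set _ _
  (\bigcup_(y in B) [set D | component F D /\ D y])).
  by move=> D [cD [y [Dy By]]]; exists y.
apply: bigcup_finite => // y By.
case: (pselect (exists D, component F D /\ D y)) => [[D [cD Dy]]|nD].
  apply: (@sub_finite_set _ _ [set D]); last exact: finite_set1.
  by move=> E [cE Ey]; apply: component_eq cE cD _; exists y.
by apply: (@sub_finite_set _ _ set0) => // D ?; apply: nD; exists D.
Qed.

Lemma finite_subset_increasing_union (T : Type) (A : set T) (H : nat -> set T) :
  finite_set A -> (forall m n, m <= n -> H m `<=` H n) ->
  A `<=` \bigcup_n H n -> exists n, A `<=` H n.
Proof.
move=> finA mH AH.
have HN x : exists n, A x -> H n x.
  by case: (pselect (A x)) => [/AH[n _ ?]|]; [exists n|exists 0].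
have [N HN'] := choice HN.
have [n Hn] := finite_bound N finA; exists n => x Ax.
exact: mH (Hn _ Ax) _ (HN' _ Ax).
Qed.

(** The sets [B m] below are the bounded pieces.  [idx F'] numbers the components
    of [G \ F'] that contain ends, [X O] is an exhaustion of the class [O] by good
    regions, and [K E] an increasing sequence of bounded sets covering the ends
    of the good region [E]. *)
Lemma finitely_bad_sigma_bounded : sigma_bounded (ends_in C).
Proof.
have Hidx F : exists idx : set G -> nat, finite_set F ->
    {in (fun e => end_component e F) @` setT &, injective idx}.
  case: (pselect (finite_set F)) => finF; last by exists (fun=> 0).
  by have /countable_injP[idx ?] := countC finF; exists idx.
have {Hidx}[idx Hidx] := choice Hidx.
have HK E : exists K : nat -> set (graph_end G), good E ->
    [/\ forall n, bounded (K n), forall m n, m <= n -> K m `<=` K n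
      & ends_in E `<=` \bigcup_n K n].
  case: (pselect (good E)) => [[_ _ /sigma_bounded_increasing[K HK]]|].
    by exists K.
  by exists (fun=> set0).
have {HK}[K HK] := choice HK.
have HX O : exists H : nat -> set G, forall x, cls x x -> cls x = O ->
    [/\ forall n, good (H n), forall m n, m <= n -> H m `<=` H n & O = \bigcup_n H n].
  case: (pselect (exists2 x, cls x x & cls x = O)) => [[x xx xO]|nO].
    have [H HH] := cls_exhaustion xx; exists H => y _ _.
    by rewrite -xO.
  by exists (fun=> set0) => x xx xO; case: nO; exists x.
have {HX}[X HX] := choice HX.
pose B m : set (graph_end G) := [set e | ends_in C e /\
  forall x E, good E -> E x -> ends_in E e ->
    (finite_set (boundary (cls x)) -> idx (boundary (cls x)) (cls x) <= m) /\
    (forall n, ends_in (X (cls x) n) e ->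
       exists2 j, j <= n & K (X (cls x) j) m e)].
have clsE x E : good E -> E x -> cls x x by move=> gE Ex; exists E.
exists B; last first.
  move=> e eC.
  case: (pselect (exists E x, [/\ good E, E x & ends_in E e])); last first.
    by move=> nE; exists 0 => //; split=> // x E gE Ex eE; case: nE; exists E, x.
  move=> [E0 [x0 [gE0 E0x0 eE0]]].
  have same x E : good E -> E x -> ends_in E e -> cls x = cls x0.
    move=> gE Ex eE; have [rE _ _] := gE.
    have [w [Ew E0w]] := ends_in_meet rE eE eE0.
    by rewrite (cls_eq (good_cls gE Ex Ew)) -(cls_eq (good_cls gE0 E0x0 E0w)).
  pose O := cls x0.
  have [gX mX OX] := HX O x0 (clsE _ _ gE0 E0x0) erefl.
  pose k := idx (boundary O) O.
  have [m Hm] : exists m, forall n, ends_in (X O n) e ->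
      exists2 j, j <= n & K (X O j) m e.
    case: (pselect (exists n, ends_in (X O n) e)) => [exn|nn]; last first.
      by exists 0 => n Xn; case: nn; exists n.
    have exn' : exists n, `[< ends_in (X O n) e >].
      by case: exn => n ?; exists n; apply/asboolP.
    case: (ex_minnP exn') => j /asboolP Xj jm.
    have [_ _ /(_ _ Xj)[m _ Km]] := HK _ (gX j).
    by exists m => n /asboolP/jm jn; exists j.
  (* [k] is only meaningful when the boundary of [O] is finite. *)
  exists (maxn k m) => //; split=> // x E gE Ex eE.
  rewrite (same x E gE Ex eE); split=> [_|n /Hm[j jn Kj]]; first exact: leq_maxl.
  exists j => //; have [_ + _] := HK _ (gX j); apply; first exact: leq_maxr.
  exact: Kj.
move=> m; apply: (@bounded_superset _ _ (boundary C)); first by have [] := rC.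
move=> F finF bCF.
pose S1 := [set D | exists e, [/\ ends_in C e, D = end_component e F &
                                   ~ sigma_bounded (ends_in D)]].
(* [S1] collects the bad components, [S2] the good ones that are whole classes,
   and [T z] those in the class of [z] that have a neighbour in it. *)
pose S2 := \bigcup_(F' in [set F' | F' `<=` F])
  [set D | ((fun e => end_component e F') @` setT) D /\ idx F' D <= m].
have finS2 : finite_set S2.
  apply: bigcup_finite; first exact: finite_powerset.
  move=> F' F'F; have finF' := sub_finite_set F'F finF.
  set T := [set D | _].
  have injT : {in T &, injective (idx F')}.
    by move=> D D' /set_mem[iD _] /set_mem[iD' _]; apply: Hidx; rewrite ?inE.
  have : finite_set (idx F' @` T).
    apply: (@sub_finite_set _ _ `I_m.+1) => // _ [D [_ Dm] <-] /=.
    by rewrite ltnS.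
  by rewrite (eq_finite_set (inj_card_eq injT)).
have HT z : exists T : set (set G), finite_set T /\
    forall e, B m e -> let D := end_component e F in
      good D -> D `<=` cls z -> boundary D `&` cls z !=set0 -> T D.
  case: (pselect (cls z z)) => [zz|nz]; last first.
    exists set0; split=> // e _ D [[[[x Dx] _] _] _ _] /(_ _ Dx)[E [gE Ez] _] _.
    by case: nz; exact: clsE Ez.
  have [gX mX OX] := HX _ z zz erefl.
  set H := X (cls z) in gX mX OX.
  have [n Hn] : exists n, F `&` cls z `<=` H n.
    apply: finite_subset_increasing_union => //; first exact: finite_setIl.
    by rewrite -OX => y [].
  (* A component that misses the boundary of [H n] but is adjacent to [H n] lies
     inside [H n]. *)
  exists ([set D | component F D /\ D `&` boundary (H n) !=set0] `|`
    (fun e => end_component e F) @` \bigcup_(j in [set j | j <= n]) K (H j) m).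
  split.
    rewrite finite_setU; split.
      by apply: finite_components_meeting; have [[]] := gX n.
    apply: (bounded_bigcup _ _ finF); first exact: (@sub_finite_set _ _ `I_n.+1).
    by move=> j _; have [] := HK _ (gX j).
  move=> e [_ HB] D gD Dz [y [bDy zy]].
  have [bD|/eqP/set0P ?] := EM (D `&` boundary (H n) = set0); last first.
    by left; split=> //; exact: end_component_comp.
  right; have Hy : H n y.
    by apply: Hn; split=> //; exact: (end_component_boundary finF bDy).
  have [_ [d Dd dy]] := bDy.
  have Hd : H n d.
    apply: contrapT => nHd; have : (D `&` boundary (H n)) d.
      by split=> //; split=> //; exists y => //; exact: adj_sym.
    by rewrite bD.
  have DH : D `<=` H n.
    apply: connected_absorb => //; first exact: end_component_connected.
    by exists d.
  have eD := end_component_ends e finF.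
  have [_ ] := HB d D gD Dd eD; rewrite -(cls_eq (Dz _ Dd)) => /(_ n (ends_inS DH eD)).
  by move=> [j jn Kj]; exists e => //; exists j.
have {HT}[T HT] := choice HT.
apply: (@sub_finite_set _ _ (S1 `|` S2 `|` \bigcup_(z in F) T z)); last first.
  rewrite !finite_setU; split; first by split=> //; exact: finitelyBad.
  by apply: bigcup_finite => // z _; have [] := HT z.
move=> _ [e Be <-]; set D := end_component e F.
have [eC HB] := Be.
case: (pselect (sigma_bounded (ends_in D))) => sD; last by left; left; exists e.
have gD : good D.
  split=> //; first exact: end_component_region.
  exact: end_component_subset.
have [[x Dx] _] := end_component_connected e finF.
have eD := end_component_ends e finF.
have Dcls := good_cls gD Dx.
(* Either [D] is a whole class, controlled by its number, or a boundary vertex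
   of [D], which belongs to [F], lies in the same class. *)
have [bD|/eqP/set0P[z [bz clz]]] := EM (boundary D `&` cls x = set0).
  left; right; have clD := cls_isolated gD Dx bD.
  have bF : boundary D `<=` F by exact: end_component_boundary.
  exists (boundary D) => //; split.
    exists e => //; apply: region_end_component => //.
    by have [] := gD.
  have [+ _] := HB x D gD Dx eD; rewrite clD; apply.
  by have [[]] := gD.
right; exists z; first exact: (end_component_boundary finF bz).
have [_ /(_ e Be)] := HT z; apply=> //; rewrite -(cls_eq clz) //.
by exists z.
Qed.

End FiniteBranching.

(** * A closed copy of the Baire space from a branching scheme of regions *)

(** The first [n] values of [x], latest first, so that extending a sequence is
    [cons] and the extensions of [s] are the sequences [u ++ s]. *)
Fixpoint stem (x : nat -> nat) n : seq nat :=
  if n is m.+1 then x m :: stem x m else [::].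

Lemma size_stem x n : size (stem x n) = n.
Proof. by elim: n => //= n ->. Qed.

Lemma stem_eqP x y n : stem x n = stem y n <-> forall i, i < n -> x i = y i.
Proof.
elim: n => [|n IH] //=; split=> [[xy /IH H] i|H].
  by rewrite ltnS leq_eqVlt => /orP[/eqP->//|/H].
by rewrite H //; congr cons; apply/IH => i /ltnW; exact: H.
Qed.

Section BaireScheme.
Variables (G : graph) (C S : seq nat -> set G) (a : seq nat -> G).
Hypothesis regC : forall s, region (C s).
Hypothesis finS : forall s, finite_set (S s).
Hypothesis connS : forall s, gconnected (S s).
Hypothesis Sa : forall s, S s (a s).
Hypothesis SC : forall s, S s `<=` C s.
Hypothesis CC : forall n s, C (n :: s) `<=` C s.
Hypothesis CS : forall n s, C (n :: s) `&` S s = set0.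
Hypothesis bC : forall n s, boundary (C (n :: s)) `<=` boundary (C s) `|` S s.
Hypothesis link : forall n s, exists2 z, S s z & adj z (a (n :: s)).
Hypothesis disj : forall i j s, C (i :: s) `&` C (j :: s) !=set0 -> i = j.

(** Along a branch these sets, unlike the regions [C s], leave every vertex
    behind; this makes the end of a branch unique. *)
Let T s : set G := \bigcup_u S (u ++ s).

Lemma scheme_subset u s : C (u ++ s) `<=` C s.
Proof. by elim: u => //= n u IH x /CC/IH. Qed.

Lemma scheme_tree_connected s : gconnected (T s).
Proof.
apply: (@gconnected_star _ _ (a s)); first by exists [::].
move=> x [u _ Sx]; suff [D [cD DT Da SD]] : exists D,
    [/\ gconnected D, D `<=` T s, D (a s) & S (u ++ s) `<=` D].
  by exists D; split=> //; exact: SD.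
elim: u {x Sx} => [|n u [D [cD DT Da SD]]] /=.
  by exists (S s); split=> // x Sx; exists [::].
have [z Sz za] := link n (u ++ s).
exists (D `|` S (n :: u ++ s)); split; [|
  by move=> x [/DT//|Sx]; exists (n :: u) | by left | by move=> x; right].
exact: (gconnectedU_adj cD (connS _) (SD _ Sz) (Sa _) za).
Qed.

Lemma scheme_tree_subset s : T s `<=` C s.
Proof. by move=> x [u _ /SC]; exact: scheme_subset. Qed.

Lemma scheme_level s t : size s = size t -> C s `&` C t !=set0 -> s = t.
Proof.
elim: s t => [|n s IH] [|m t] //= [/IH st] [x [Cs Ct]].
have E : s = t by apply: st; exists x; split; [exact: CC Cs|exact: CC Ct].
by subst t; congr cons; apply: (@disj _ _ s); exists x.
Qed.

Lemma scheme_avoids s t v : S t v -> size s = (size t).+1 -> ~ C s v.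
Proof.
case: s => //= n s Sv [st] Cv; have E : s = t.
  by apply: scheme_level => //; exists v; split; [exact: CC Cv|exact: SC].
subst t; have : (C (n :: s) `&` S s) v by [].
by rewrite CS.
Qed.

(** A vertex of [S t] is deleted when passing to level [(size t).+1]. *)
Lemma scheme_branch_vanishes x v : exists n, ~ T (stem x n) v.
Proof.
case: (pselect (exists t, S t v)) => [[t St]|nS]; last first.
  by exists 0 => -[u _ Su]; apply: nS; exists (u ++ stem x 0).
exists (size t).+1 => /scheme_tree_subset; apply: scheme_avoids St _.
by rewrite size_stem.
Qed.

Lemma scheme_tree_step x n : T (stem x n.+1) `<=` T (stem x n).
Proof. by move=> v [u _ Sv]; exists (rcons u (x n)) => //; rewrite cat_rcons. Qed.

Lemma scheme_end x : exists e : graph_end G, forall n, ends_in (T (stem x n)) e.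
Proof.
apply: end_of_chain => [n|n|v]; first exact: scheme_tree_connected.
  exact: scheme_tree_step.
exact: scheme_branch_vanishes.
Qed.

Section Embedding.
Variable e : (nat -> nat) -> graph_end G.
Hypothesis eT : forall x n, ends_in (T (stem x n)) (e x).

Lemma embed_region x n : ends_in (C (stem x n)) (e x).
Proof. exact: ends_inS (@scheme_tree_subset _) _ (eT x n). Qed.

Lemma embed_stem s y : ends_in (C s) (e y) -> s = stem y (size s).
Proof.
move=> ey; apply: scheme_level; first by rewrite size_stem.
exact: ends_in_meet (regC s) ey (embed_region y _).
Qed.

(** For large [n] the connected set [T (stem x n)] avoids [F], and the end of
    every branch through [stem x n] lies on the same side of [F] as this set. *)
Lemma embed_local x (F : set G) : finite_set F -> exists n, forall y,
  stem y n = stem x n -> end_component (e y) F = end_component (e x) F.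
Proof.
move=> finF; have [n Hn] := chain_end_component
  (fun n => scheme_tree_connected (stem x n)) (@scheme_tree_step x)
  (scheme_branch_vanishes x) finF (eT x).
exists n => y yx; apply: component_eq;
  [exact: end_component_comp|exact: end_component_comp|].
have [r er rT] := eT y n.
have [v [Tv Cv]] := has_tail_in_meet rT (end_component_tail finF er).
by exists v; split=> //; apply: (Hn n (leqnn n)); rewrite -yx.
Qed.

Lemma embed_inj : injective e.
Proof.
move=> x y xy; apply/funext => i; apply: (stem_eqP x y i.+1).1 => //.
by rewrite (@embed_stem (stem x i.+1) y) ?size_stem // -xy; exact: embed_region.
Qed.

(** A limit [c] of ends [e y] that lies in [C s] must lie in a child of [C s]:
    after deletion of [S s] it has a component in common with some [e y], and
    this one lies in the child that [y] selects.  So [c] selects a branch [x],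
    and [embed_local] shows that it equals [e x]. *)
Lemma embed_closed : closed (range e : set (end_space G)).
Proof.
move=> c /closure_endP Hc.
have tr s : ends_in (C s) c -> forall F, finite_set F -> boundary (C s) `<=` F ->
    exists y, [/\ end_component (e y) F = end_component c F & stem y (size s) = s].
  move=> cs F finF bF; have [_ [y _ <-] yF] := Hc F finF; exists y; split=> //.
  apply/esym/embed_stem; apply: ends_inS (end_component_ends (e y) finF).
  by rewrite yF; exact: end_component_subset.
have root : ends_in (C [::]) c.
  have [_ finb] := regC [::].
  have [_ [y _ <-] yF] := Hc _ finb.
  rewrite -(region_end_component (regC [::]) (embed_region y 0)) yF.
  exact: end_component_ends.
have step s : exists n, ends_in (C s) c -> ends_in (C (n :: s)) c.
  case: (pselect (ends_in (C s) c)) => [cs|]; last by exists 0.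
  have finF : finite_set (boundary (C s) `|` S s).
    by rewrite finite_setU; split=> //; have [] := regC s.
  have [y [yF ys]] := tr s cs _ finF (@subsetUl _ _ _).
  exists (y (size s)) => _.
  apply: ends_inS (end_component_ends c finF); rewrite -yF.
  apply: end_component_subset => //.
  by have := embed_region y (size s).+1; rewrite /= ys.
have [nx Hnx] := choice step.
pose st n := iter n (fun s => nx s :: s) [::].
pose x n := nx (st n).
have stx n : stem x n = st n by elim: n => //= n ->.
have cx n : ends_in (C (stem x n)) c.
  by rewrite stx; elim: n => //= n IH; exact: Hnx.
exists x => //; apply: end_eqP => F finF.
have [n Hn] := embed_local x finF.
have finF' : finite_set (F `|` boundary (C (stem x n))).
  by rewrite finite_setU; split=> //; have [] := regC (stem x n).
have [y [yF ys]] := tr _ (cx n) _ finF' (@subsetUr _ _ _).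
rewrite size_stem in ys; rewrite -(Hn y ys).
exact: end_component_mono finF' (@subsetUl _ _ _) yF.
Qed.


Lemma near_stem (x : baire_space) m :
  \forall y \near x, stem y m = stem x m.
Proof.
elim: m => [|m IH]; first by apply: filterE.
have Hm : \forall y \near x, y m = x m.
  by have := @proj_continuous _ (fun=> nat : topologicalType) m x _ (discrete_set1 (x m)).
by apply: filterS2 IH Hm => y /= -> ->.
Qed.

Lemma embed_continuous : continuous (e : baire_space -> end_space G).
Proof.
move=> x V /nbhs_endP[F finF FV].
have [n Hn] := embed_local x finF.
apply: filterS (near_stem x n) => y yx; apply: FV.
by rewrite end_basicE //=; exact: Hn.
Qed.

(** The regions [C s] recover the branch from the end, which makes the inverse
    of the embedding continuous. *)
Lemma embed_open_map x n :
  \forall c \near (e x : end_space G), forall y, e y = c -> y n = x n.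
Proof.
apply/nbhs_endP; have [cC finb] := regC (stem x n.+1).
exists (boundary (C (stem x n.+1))) => // c; rewrite end_basicE //= => cx y yc.
have /stem_eqP H : stem y n.+1 = stem x n.+1.
  rewrite -{1}(size_stem x n.+1); apply/esym/embed_stem; rewrite yc.
  apply: ends_inS (end_component_ends c finb); rewrite cx.
  by apply: end_component_subset => //; exact: embed_region.
exact: H.
Qed.

Lemma scheme_baire : contains_closed_copy (end_space G) baire_space.
Proof.
exists (range e); first exact: embed_closed.
pose g (x : baire_space) : set_type (range e) := SigSub (mem_set (imageT e x)).
have Hf (c : set_type (range e)) : exists x, e x = val c.
  by have /set_mem[x _ xc] := valP c; exists x.
have [f Hf'] := choice Hf.
exists f, g; split.
- move=> c; apply/cvg_sup; first exact/fmap_filter/nbhs_filter.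
  move=> n V [W [[U oU UW] Wc] WV].
  have near_c : \forall c' \near (val c : end_space G),
      forall y, e y = c' -> y n = f c n.
    by rewrite -(Hf' c); exact: embed_open_map.
  have H : \forall c' \near c, forall y, e y = val c' -> y n = f c n.
    exact: (@initial_continuous _ _ (@set_val _ (range e)) c _ near_c).
  suff : nbhs c (f @^-1` V) by [].
  apply: filterS H => c' Hc'; apply: WV; rewrite -UW /=.
  rewrite (Hc' (f c')) ?Hf' //; by rewrite -UW in Wc.
- apply: continuous_comp_initial; exact: embed_continuous.
- by move=> c; apply: val_inj; rewrite /= Hf'.
- by move=> x; apply: embed_inj; rewrite Hf'.
Qed.

End Embedding.
End BaireScheme.

(** * The dichotomy for Lindelof end spaces *)

Section HurewiczDichotomy.
Variable G : graph.
Implicit Types (C D E F S : set G).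

Let bad C := region C /\ ~ sigma_bounded (ends_in C).

Lemma infinite_enum (T : Type) (A : set T) : infinite_set A ->
  exists2 f : nat -> T, injective f & forall n, A (f n).
Proof.
move=> /infiniteP/card_leP/unsquash f.
exists (fun n => val (f (SigSub (mem_set (Logic.I : [set: nat] n))))).
  by move=> i j /val_inj ij; have /(congr1 val) := inj (mem_set Logic.I) (mem_set Logic.I) ij.
by move=> n; exact: set_mem (valP (f _)).
Qed.

(** One step of the scheme.  Enlarging the part of [F] inside [C] to a connected
    set [S] through [a] destroys only finitely many of the bad components, since
    the finite set [S] meets finitely many components of [G \ F].  As [C] is
    connected, each remaining one has a neighbour in [S]. *)
Lemma bad_split C a F : bad C -> C a -> finite_set F -> boundary C `<=` F ->
  infinite_set [set D | exists e, [/\ ends_in C e, D = end_component e F &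
                                     ~ sigma_bounded (ends_in D)]] ->
  exists (S : set G) (D : nat -> set G) (b : nat -> G),
    [/\ finite_set S, gconnected S, S a & S `<=` C] /\
    forall n, [/\ bad (D n) /\ D n (b n), D n `<=` C, D n `&` S = set0,
      boundary (D n) `<=` boundary C `|` S & exists2 z, S z & adj z (b n)] /\
      forall m, D n `&` D m !=set0 -> n = m.
Proof.
move=> [[cC finb] badC] Ca finF bF; set Bad := [set D | _] => infBad.
have [S [finS cS SC FS Sa]] := finite_connected_hull cC (finite_setIr C finF)
  (@subIsetl _ C F) Ca.
pose Touch := [set D | component F D /\ D `&` S !=set0].
have infD : infinite_set (Bad `\` Touch).
  apply: infinite_setD => //; exact: finite_components_meeting.
have [D injD DP] := infinite_enum infD.
have compD n : component F (D n).
  by have [[e [_ -> _]] _] := DP n; exact: end_component_comp.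
have DC n : D n `<=` C.
  by have [[e [eC -> _]] _] := DP n; exact: end_component_subset.
have DS n : D n `&` S = set0.
  have [_ nT] := DP n; apply: contrapT => /eqP/set0P DS; exact: nT.
have connD n : gconnected (D n) by have [] := compD n.
have bD n : boundary (D n) `<=` boundary C `|` S.
  move=> y bDy; have Fy := component_boundary (compD n) bDy.
  case: (pselect (C y)) => Cy; first by right; apply: FS.
  left; split=> //; have [_ [x Dx xy]] := bDy.
  by exists x => //; exact: DC Dx.
have Hb n : exists b, D n b /\ exists2 z, S z & adj z b.
  have [/eqP/set0P[z [Cz bz]]|CD] := pselect (C `&` boundary (D n) <> set0).
    have [_ [b Db bz']] := bz; exists b; split=> //; exists z; last exact: adj_sym.
    by apply: FS; split=> //; exact: (component_boundary (compD n)).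
  have : (D n `&` S) a.
    split=> //; apply: (connected_absorb cC) => //; last exact: contrapT.
    by have [[x Dx] _] := connD n; exists x; split=> //; exact: DC Dx.
  by rewrite DS.
have [b bP] := choice Hb.
exists S, D, b; split=> // n; split.
  have [Db Sb] := bP n; split=> //; split=> //; split.
    split=> //; exact: sub_finite_set (component_boundary (compD n)) finF.
  by have [[e [_ -> ?]] _] := DP n.
by move=> m nm; apply: injD; exact: component_eq nm.
Qed.

(** Each node of the scheme is a bad region with a marked vertex, which is
    adjacent to the connected set chosen in the parent node and has to belong
    to the one chosen in the node itself. *)
Lemma branching_baire C0 : bad C0 ->
  (forall C, bad C -> exists2 F, finite_set F & boundary C `<=` F /\
    infinite_set [set D | exists e, [/\ ends_in C e, D = end_component e F &
                                     ~ sigma_bounded (ends_in D)]]) ->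
  contains_closed_copy (end_space G) baire_space.
Proof.
move=> bad0 H.
have step (p : set G * G) : exists q : set G * (nat -> set G * G),
  bad p.1 /\ p.1 p.2 ->
  [/\ finite_set q.1, gconnected q.1, q.1 p.2 & q.1 `<=` p.1] /\
  forall n, [/\ bad (q.2 n).1 /\ (q.2 n).1 (q.2 n).2, (q.2 n).1 `<=` p.1,
    (q.2 n).1 `&` q.1 = set0, boundary (q.2 n).1 `<=` boundary p.1 `|` q.1 &
    exists2 z, q.1 z & adj z (q.2 n).2] /\
    forall m, (q.2 n).1 `&` (q.2 m).1 !=set0 -> n = m.
  case: (pselect (bad p.1 /\ p.1 p.2)) => [[bp p12]|np].
    have [F finF [bF infF]] := H _ bp.
    have [S [D [b HS]]] := bad_split bp p12 finF bF infF.
    by exists (S, fun n => (D n, b n)).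
  by exists (set0, fun=> p) => /np.
have {step}[q Hq] := choice step.
have [[a0 Ca0] _] := bad0.1.1.
pose node := fix node (s : seq nat) : set G * G :=
  if s is n :: s' then (q (node s')).2 n else (C0, a0).
have ok s : bad (node s).1 /\ (node s).1 (node s).2.
  by elim: s => // n s /Hq[_ /(_ n)[[]]].
pose C s := (node s).1; pose S s := (q (node s)).1; pose a s := (node s).2.
have regC s : region (C s) by have [[]] := ok s.
have HS s : [/\ finite_set (S s), gconnected (S s), S s (a s) & S s `<=` C s].
  by have [] := Hq _ (ok s).
have HC n s : [/\ C (n :: s) `<=` C s, C (n :: s) `&` S s = set0,
    boundary (C (n :: s)) `<=` boundary (C s) `|` S s,
    exists2 z, S s z & adj z (a (n :: s)) &
    forall m, C (n :: s) `&` C (m :: s) !=set0 -> n = m].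
  by have [_ /(_ n)[[]]] := Hq _ (ok s).
have H1 s := let: And4 x _ _ _ := HS s in x.
have H2 s := let: And4 _ x _ _ := HS s in x.
have H3 s := let: And4 _ _ x _ := HS s in x.
have H4 s := let: And4 _ _ _ x := HS s in x.
have H5 n s := let: And5 x _ _ _ _ := HC n s in x.
have H6 n s := let: And5 _ x _ _ _ := HC n s in x.
have H7 n s := let: And5 _ _ x _ _ := HC n s in x.
have H8 n s := let: And5 _ _ _ x _ := HC n s in x.
have H9 n m s := let: And5 _ _ _ _ x := HC n s in x m.
have [e eT] := choice (scheme_end H2 H3 H4 H5 H6 H8 H9).
exact: (scheme_baire regC H1 H2 H3 H4 H5 H6 H7 H8 H9 eT).
Qed.

(** Hurewicz's dichotomy, known for analytic metrizable spaces; Lindelof end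
    spaces need not be metrizable. *)
Theorem lindelof_dichotomy : lindelof (end_space G) ->
  sigma_compact (end_space G) \/ contains_closed_copy (end_space G) baire_space.
Proof.
move=> /lindelof_countable_components cG.
case: (pselect (sigma_bounded [set: graph_end G])) => [/sigma_bounded_sigma_compact|nT].
  by left.
right.
have [C0 bad0] : exists C, bad C.
  apply: contrapT => nbad; apply: nT.
  apply: (@sigma_boundedS _ _ (\bigcup_(C in (fun e => end_component e set0) @` setT) ends_in C)).
    move=> e _; exists (end_component e set0); first by exists e.
    exact: end_component_ends.
  apply: sigma_bounded_bigcup; first exact: cG.
  move=> _ [e _ <-]; apply: contrapT => ne; apply: nbad.
  by exists (end_component e set0); split=> //; exact: end_component_region.
apply: branching_baire bad0 _ => C [rC badC].
apply: contrapT => nF; apply: badC; apply: finitely_bad_sigma_bounded => // F finF bF.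
by apply: contrapT => infF; apply: nF; exists F.
Qed.

End HurewiczDichotomy.

(** * The Menger property *)

Section Menger.
Variable X : topologicalType.

(** The finite subfamilies, directed by inclusion, form the filter in the
    near-covering form of compactness. *)
Lemma compact_open_covering (K : set X) (U : set (set X)) : compact K -> U `<=` open ->
  K `<=` \bigcup_(A in U) A ->
  exists V, [/\ V `<=` U, finite_set V & K `<=` \bigcup_(A in V) A].
Proof.
move=> /compact_near_coveringP cK oU KU.
pose D := [set V | V `<=` U /\ finite_set V].
pose Fil := filter_from D (fun V => [set W | D W /\ V `<=` W]).
have FilF : Filter Fil.
  apply: filter_from_filter; first by exists set0; split.
  move=> V W [VU fV] [WU fW]; exists (V `|` W).
    by split; [move=> A [/VU|/WU]|rewrite finite_setU].
  by move=> Z [DZ VWZ]; split; split=> // A ?; apply: VWZ; [left|right].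
have [|V [VU fV] HV] := cK _ Fil (fun V x => (\bigcup_(A in V) A) x) FilF.
  move=> x /KU[A UA Ax]; exists (A, [set V | D V /\ [set A] `<=` V]).
    split; first by apply: open_nbhs_nbhs; split=> //; exact: oU.
    by exists [set A] => //; split; [move=> _ ->|exact: finite_set1].
  by move=> [y V] /= [Ay [_ AV]]; exists A => //; exact: AV.
by exists V; split=> //; apply: HV; split.
Qed.

Lemma sigma_compact_menger : sigma_compact X -> menger X.
Proof.
move=> [K cK KT] U oU.
have H n : exists V, [/\ V `<=` U n, finite_set V & K n `<=` \bigcup_(A in V) A].
  apply: compact_open_covering => //; first by have [] := oU n.
  by have [_ ->] := oU n.
have [V HV] := choice H.
exists V; split=> [n|n|]; [by have [] := HV n|by have [] := HV n|].
apply/seteqP; split=> // x _.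
have [n _ Knx] : (\bigcup_n K n) x by rewrite KT.
by exists n => //; have [_ _] := HV n; apply.
Qed.

Lemma menger_lindelof : menger X -> lindelof X.
Proof.
move=> M U oU; have [F [FU fF FT]] := M (fun=> U) (fun=> oU).
exists (\bigcup_n F n); split.
- by move=> A [n _ /FU].
- by apply: bigcup_countable => // n _; exact: finite_set_countable.
- apply/seteqP; split=> // x _.
  have [n _ [A FA Ax]] : (\bigcup_n \bigcup_(A in F n) A) x by rewrite FT.
  by exists A => //; exists n.
Qed.

(** The [n]-th cover consists of the open sets on whose trace the [n]-th
    coordinate is bounded.  Finite subfamilies bound it by [k n], and the point
    with coordinates [(k n).+1] is missed. *)
Lemma menger_no_baire : menger X -> ~ contains_closed_copy X baire_space.
Proof.
move=> M [A cA [f [g [cf cg fg gf]]]].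
pose U n := [set W : set X | open W /\
  exists k, forall a : set_type A, W (val a) -> f a n <= k].
have [|F [FU fF FT]] := M U.
  move=> n; split; first by move=> W [].
  apply/seteqP; split=> // x _; case: (pselect (A x)) => Ax; last first.
    exists (~` A) => //; split; first exact: closed_openC.
    by exists 0 => a; have /set_mem := valP a.
  pose a : set_type A := SigSub (mem_set Ax).
  have : nbhs a [set b | f b n = f a n].
    have := @proj_continuous _ (fun=> nat : topologicalType) n (f a) _ (discrete_set1 (f a n)).
    exact: cf.
  rewrite nbhsE => -[V [[W oW WV] Va] Vf].
  exists W; last by rewrite -WV in Va.
  split=> //; exists (f a n) => b Wb.
  by rewrite (Vf b) //= -WV.
have Hk n : exists k, forall W, F n W -> forall a : set_type A, W (val a) -> f a n <= k.
  have HW W : exists k, F n W -> forall a : set_type A, W (val a) -> f a n <= k.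
    by case: (pselect (F n W)) => [/FU[_ [k ?]]|]; [exists k|exists 0].
  have [k kP] := choice HW.
  have [N HN] := finite_bound k (fF n).
  by exists N => W FW a Wa; exact: leq_trans (kP W FW a Wa) (HN W FW).
have [k kP] := choice Hk.
pose a := g (fun n => (k n).+1 : nat).
have [n _ [W FW Wa]] : (\bigcup_n \bigcup_(A in F n) A) (val a) by rewrite FT.
by have := kP n W FW a Wa; rewrite /a gf ltnn.
Qed.

End Menger.

Theorem corollary6p7 (G : graph) :
  [<-> sigma_compact (end_space G);
       menger (end_space G);
       lindelof (end_space G) /\
         ~ contains_closed_copy (end_space G) baire_space].
Proof.
tfae; first exact: sigma_compact_menger.
- by move=> M; split; [exact: menger_lindelof|exact: menger_no_baire].
- by move=> [/lindelof_dichotomy[]].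
Qed.
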